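(* Let $k\ge1$ be an integer and let $G\in V_k\Lambda^3(K)$ be a polynomial 3-form for which all the degrees of freedom $\Sigma^{k,3}(K)$ vanish. Then $G\equiv0$.
   Context: $K\subset\mathbb R^4$ is the pentatope (4-simplex) with vertices $(0,0,0,0),(1,0,0,0),(0,1,0,0),(0,0,1,0),(0,0,0,1)$; it has 5 tetrahedral facets. $P^j$ denotes polynomials of total degree $\le j$ on the indicated set ($\{0\}$ if $j<0$), $\tilde P^j$ homogeneous polynomials of degree exactly $j$ (together with $0$). The space is $$V_k\Lambda^3(K)=(P^{k-1}(K))^4\oplus\tilde P^{k-1}(K)\,x,\qquad x=(x_1,x_2,x_3,x_4).$$ Degrees of freedom $\Sigma^{k,3}(K)$ of $G$: - $\int_{\mathcal F}(G\cdot n)\,q$, $q\in P^{k-1}(\mathcal F)$, for each tetrahedral facet $\mathcal F$ with unit normal $n$; - $\int_KG\cdot q$, $q\in(P^{k-2}(K))^4$. *)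

(* Defs.v *)
From HB Require Import structures.
From mathcomp Require Import all_boot all_order all_algebra.
(* The notations of mpoly clash with those of mathcomp-analysis. *)
From mathcomp Require Import -(notations) mpoly.
From mathcomp Require Import all_classical all_reals all_analysis.

Set Implicit Arguments.
Unset Strict Implicit.
Unset Printing Implicit Defensive.

Import Order.TTheory GRing.Theory Num.Theory.

Local Open Scope classical_set_scope.
Local Open Scope ring_scope.

Section Pentatope.
Variable R : realType.

Definition dot (x y : 'rV[R]_4) : R := \sum_j x 0 j * y 0 j.

Definition convex_hull (m : nat) (v : 'I_m -> 'rV[R]_4) : set 'rV[R]_4 :=
  [set x | exists w : 'I_m -> R,
     [/\ forall i, 0 <= w i, \sum_i w i = 1 & x = \sum_i w i *: v i]].

(* vertex 0 is the origin, vertex (lift ord0 j) is the j-th standard basis vector. *)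
Definition vertex (i : 'I_5) : 'rV[R]_4 :=
  if unlift ord0 i is Some j then delta_mx 0 j else 0.

Definition pentatope : set 'rV[R]_4 := convex_hull vertex.

(* The i-th facet is the one opposite to vertex i. *)
Definition facet_vertex (i : 'I_5) (m : 'I_4) : 'rV[R]_4 := vertex (lift i m).

Definition facet (i : 'I_5) : set 'rV[R]_4 := convex_hull (facet_vertex i).

(* Both unit normals (inward and outward) satisfy this predicate. *)
Definition unit_normal (i : 'I_5) (n : 'rV[R]_4) : Prop :=
  dot n n = 1 /\
  forall x y, facet i x -> facet i y -> dot n (x - y) = 0.

(* msize p is the total degree of p plus one, so that for j = -1 the condition
   reads p = 0. *)
Definition mdegree_le (j : int) (p : mpoly 4 R) : bool :=
  (p == 0) || ((msize p)%:Z <= j + 1).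

Definition mpoly_fun (p : mpoly 4 R) (x : 'rV[R]_4) : R :=
  meval (fun j => x 0 j) p.

(* P^j(D); functions are only constrained on D.  When D is a facet this is the
   space of restrictions to D of polynomials in four variables, i.e. of
   polynomials of degree at most j in affine coordinates of the facet. *)
Definition poly_space (j : int) (D : set 'rV[R]_4) : set ('rV[R]_4 -> R) :=
  [set f | exists2 p, mdegree_le j p & forall x, D x -> f x = mpoly_fun p x].

Definition hpoly_space (d : nat) (D : set 'rV[R]_4) : set ('rV[R]_4 -> R) :=
  [set f | exists2 p : mpoly 4 R, p \is ishomog1 d mdeg &
           forall x, D x -> f x = mpoly_fun p x].

Definition vpoly_space (j : int) (D : set 'rV[R]_4) : set ('rV[R]_4 -> 'rV[R]_4) :=
  [set f | forall c : 'I_4, poly_space j D (fun x => f x 0 c)].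

(* Vector proxies of the 3-forms; used for k >= 1 only. *)
Definition V3 (k : nat) : set ('rV[R]_4 -> 'rV[R]_4) :=
  [set G | exists f h,
     [/\ vpoly_space (k%:Z - 1) pentatope f, hpoly_space k.-1 pentatope h &
         forall x, pentatope x -> G x = f x + h x *: x]].

Local Notation leb := (@lebesgue_measure R).

Definition row3 (t : R * R * R) : 'rV[R]_3 :=
  \row_j [:: t.1.1; t.1.2; t.2]`_j.

Definition row4 (t : R * R * R * R) : 'rV[R]_4 :=
  \row_j [:: t.1.1.1; t.1.1.2; t.1.2; t.2]`_j.

Definition volume_integral (D : set 'rV[R]_4) (f : 'rV[R]_4 -> R) : R :=
  \int[(((leb \x leb) \x leb) \x leb)%E]_(t in row4 @^-1` D) f (row4 t).

Definition facet_edges (i : 'I_5) : 'M[R]_(3, 4) :=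
  \matrix_m (facet_vertex i (lift ord0 m) - facet_vertex i ord0).

(* An affine bijection from R^3 onto the affine hull of the facet. *)
Definition facet_chart (i : 'I_5) (t : R * R * R) : 'rV[R]_4 :=
  facet_vertex i ord0 + row3 t *m facet_edges i.

(* Integral over the facet for the surface measure (three-dimensional Hausdorff
   measure), by the area formula: the square root of the Gram determinant of
   the edges is the constant Jacobian of the chart. *)
Definition facet_integral (i : 'I_5) (f : 'rV[R]_4 -> R) : R :=
  Num.sqrt (\det (facet_edges i *m (facet_edges i)^T)) *
  \int[((leb \x leb) \x leb)%E]_(t in facet_chart i @^-1` facet i)
    f (facet_chart i t).

Definition facet_dofs_vanish (k : nat) (G : 'rV[R]_4 -> 'rV[R]_4) : Prop :=
  forall (i : 'I_5) (n : 'rV[R]_4), unit_normal i n ->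
  forall q, poly_space (k%:Z - 1) (facet i) q ->
  facet_integral i (fun x => dot (G x) n * q x) = 0.

Definition interior_dofs_vanish (k : nat) (G : 'rV[R]_4 -> 'rV[R]_4) : Prop :=
  forall q, vpoly_space (k%:Z - 2) pentatope q ->
  volume_integral pentatope (fun x => dot (G x) (q x)) = 0.

End Pentatope.

(* Main.v *)
Require Import Defs.
From mathcomp Require Import all_boot all_order all_algebra.
From mathcomp Require Import -(notations) mpoly.
From mathcomp Require Import all_classical all_reals all_analysis.
From mathcomp Require Import measurable_realfun zify ring lra.

(** Let l_0, ..., l_4 be the barycentric coordinates of the pentatope, with
    constant gradients g_i, which sum to 0.  The proof reads a field G through
    its components G_i = G . g_i, which determine G and sum to 0.  Writing
    G = f + h x on the pentatope, x . g_i is l_i up to a constant, so that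
    G_i = Q_i + l_i h with Q_i and h of degree at most k - 1
    ([V3_bary_components]).

    On the facet l_i = 0 the normal component is a multiple of Q_i, which is
    itself an admissible test function there; hence the facet integral of Q_i^2
    is 0 and Q_i vanishes on the facet ([facet_component_eq0]).  Therefore
    Q_i = l_i r_i with deg r_i <= k - 2 ([bary_divides]), and
    G_i = l_i (r_i + h).

    The interior test field q with coordinates q_j = r_j - r_0 has the right
    degree.  As the G_i sum to 0,
      G . q = sum_i G_i r_i = sum_i G_i (r_i + h) = sum_i l_i (r_i + h)^2
    ([sum_bary_square]).  This is nonnegative on the pentatope and has integral
    0, so every term vanishes there; so does every G_i = l_i (r_i + h), and
    G = 0.

    The analytic input is that a nonnegative continuous function with integral
    0 over a simplex is 0 at all of its points, boundary included
    ([Rintegral_eq0_tame]).  It is used for the pentatope and, through the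
    charts, for its facets. *)

Set Implicit Arguments.
Unset Strict Implicit.
Unset Printing Implicit Defensive.

Import Order.TTheory GRing.Theory Num.Theory numFieldNormedType.Exports.

Local Open Scope classical_set_scope.
Local Open Scope ring_scope.

(** * Degree bounds and shifts of polynomials *)

Section Polynomials.
Variables (R : realType) (n : nat).
Implicit Types (p q l : mpoly n R) (v a : 'I_n -> R).

Lemma msizeD_bound d p q : (msize p <= d)%N -> (msize q <= d)%N ->
  (msize (p + q) <= d)%N.
Proof. by move=> hp hq; rewrite (leq_trans (msizeD_le _ _))// geq_max hp. Qed.

Lemma msizeZ_bound d c p : (msize p <= d)%N -> (msize (c *: p) <= d)%N.
Proof. exact/leq_trans/msizeZ_le. Qed.

Lemma msize_sum_bound (I : Type) (r : seq I) (P : pred I)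
    (F : I -> mpoly n R) d :
  (forall i, P i -> (msize (F i) <= d)%N) ->
  (msize (\sum_(i <- r | P i) F i) <= d)%N.
Proof.
move=> hF; elim/big_ind: _ => //; first by rewrite msize0.
by move=> p q; exact: msizeD_bound.
Qed.

Lemma msizeM_affine d l p : (msize l <= 2)%N -> (msize p <= d)%N ->
  (msize (l * p) <= d.+1)%N.
Proof.
move=> hl hp; have [->|l0] := eqVneq l 0; first by rewrite mul0r msize0.
have [->|p0] := eqVneq p 0; first by rewrite mulr0 msize0.
rewrite msizeM//.
by have := leq_add hl hp; case: (_ + _)%N.
Qed.

Lemma meval_sum v (I : Type) (r : seq I) (P : pred I) (F : I -> mpoly n R) :
  meval v (\sum_(i <- r | P i) F i) = \sum_(i <- r | P i) meval v (F i).
Proof. exact: raddf_sum. Qed.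

(** The increment of a polynomial is divisible by the step, even when the step
    [l] depends on the point.  As [l] has degree at most 1, the shifted
    polynomial has the degree of [p], and the quotient one less. *)
Lemma meval_shift a l p d : (msize l <= 2)%N -> (msize p <= d.+1)%N ->
  exists2 s, (msize s <= d)%N &
    forall v, meval (fun j => v j + meval v l * a j) p =
              meval v p + meval v l * meval v s.
Proof.
move=> hl hp.
have mono (m : multinom n) : exists2 s : mpoly n R, (msize s <= mdeg m)%N &
    forall v, meval (fun j => v j + meval v l * a j) (mpolyX R m) =
              meval v (mpolyX R m) + meval v l * meval v s.
  have [e] := ubnP (mdeg m); elim: e m => // e IH m hm.
  have [->|] := eqVneq m mnm0.
    by exists 0 => [|v]; rewrite ?msize0 // mpolyX0 !meval1 meval0 mulr0 addr0.
  move=> m0; have [i mi] : exists i, m i != 0%N.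
    apply/existsP; apply: contraR m0 => /existsPn h.
    apply/eqP/mnmP => i; rewrite mnm0E; apply/eqP.
    by have := h i; rewrite negbK.
  have le1 := mi; rewrite -lep1mP in le1.
  have em := submK le1; set m' := mnm_sub m (mnm1 i) in em.
  have dm : mdeg m = (mdeg m').+1 by rewrite -em mdegD mdeg1 addn1.
  have [|s hs Es] := IH m'; first by rewrite -ltnS -dm.
  (* Discrete product rule for the increment of 'X_i times 'X^m'. *)
  exists (mpolyX R (mnm1 i) * s + a i *: (mpolyX R m' + l * s)).
    rewrite dm; apply: msizeD_bound.
      by rewrite msizeM_affine// msizeX mdeg1.
    by apply/msizeZ_bound/msizeD_bound; [rewrite msizeX | exact: msizeM_affine].
  move=> v; rewrite -em mpolyXD !mevalM Es mevalD mevalZ !mevalM mevalD mevalM.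
  by rewrite !mevalXU; ring.
have mono' (m : multinom n) : exists s : mpoly n R, (msize s <= mdeg m)%N /\
    forall v, meval (fun j => v j + meval v l * a j) (mpolyX R m) =
              meval v (mpolyX R m) + meval v l * meval v s.
  by have [s hs Es] := mono m; exists s.
have [S hS] := choice mono'.
exists (\sum_(m <- msupp p) mcoeff m p *: S m).
  rewrite big_seq; apply: msize_sum_bound => m /msize_mdeg_lt hm.
  by apply/msizeZ_bound/(leq_trans (hS m).1); rewrite -ltnS (leq_trans hm).
move=> v; rewrite {1 2}(mpolyE p) !meval_sum mulr_sumr -big_split/=.
by apply: eq_bigr => m _; rewrite !mevalZ (hS m).2; ring.
Qed.

End Polynomials.

(** * Barycentric coordinates *)

Section Barycentric.
Variable R : realType.
Implicit Types (x y : 'rV[R]_4) (i l : 'I_5).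

Definition bary i x : R :=
  if unlift ord0 i is Some j then x 0 j else 1 - \sum_j x 0 j.

Definition bary_grad i : 'rV[R]_4 :=
  if unlift ord0 i is Some j then delta_mx 0 j else const_mx (-1).

Lemma dotC x y : dot x y = dot y x.
Proof. by apply: eq_bigr => j _; rewrite mulrC. Qed.

Lemma dotDl x y z : dot (x + y) z = dot x z + dot y z.
Proof. by rewrite -big_split; apply: eq_bigr => j _; rewrite mxE mulrDl. Qed.

Lemma dotZl a x y : dot (a *: x) y = a * dot x y.
Proof. by rewrite mulr_sumr; apply: eq_bigr => j _; rewrite mxE mulrA. Qed.

Lemma dotNl x y : dot (- x) y = - dot x y.
Proof. by rewrite -scaleN1r dotZl mulN1r. Qed.

Lemma dot_delta x j : dot x (delta_mx 0 j) = x 0 j.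
Proof.
rewrite /dot (bigD1 j)//= mxE !eqxx mulr1 big1 ?addr0// => i /negPf ij.
by rewrite mxE ij mulr0.
Qed.

(** The constant terms of the barycentric coordinates are their values at the
    origin, which is vertex 0. *)
Lemma baryE i x : bary i x = (i == ord0)%:R + dot x (bary_grad i).
Proof.
rewrite /bary /bary_grad; case: unliftP => [j|] ->.
  by rewrite dot_delta add0r.
rewrite eqxx /dot; congr (_ + _); rewrite -sumrN.
by apply: eq_bigr => j _; rewrite mxE mulrN1.
Qed.

Lemma sum_bary x : \sum_i bary i x = 1.
Proof.
rewrite big_ord_recl /bary unlift_none.
by under [X in _ + X]eq_bigr do rewrite liftK; rewrite subrK.
Qed.

Lemma sum_bary_grad x : \sum_i dot x (bary_grad i) = 0.
Proof.
apply: (addrI 1); rewrite addr0 -{2}(sum_bary x).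
under [RHS]eq_bigr do rewrite baryE.
rewrite big_split; congr (_ + _).
by rewrite (bigD1 ord0)//= big1 ?addr0// => i /negPf ->.
Qed.

Lemma bary_grad_eq0 x : (forall i, dot x (bary_grad i) = 0) -> x = 0.
Proof.
move=> h; apply/rowP => j; have := h (lift ord0 j).
by rewrite /bary_grad liftK dot_delta => ->; rewrite mxE.
Qed.

Lemma bary_vertex i l : bary i (vertex R l) = (i == l)%:R.
Proof.
rewrite /bary /vertex; case: unliftP => [j|] ->; case: unliftP => [m|] ->.
- by rewrite mxE (inj_eq lift_inj).
- by rewrite mxE.
- rewrite (bigD1 m)//= mxE !eqxx big1 ?addr0 ?subrr// => j /negPf jm.
  by rewrite mxE jm.
- by rewrite big1 ?subr0// => j; rewrite mxE.
Qed.

Lemma bary_comb n (w : 'I_n -> R) (v : 'I_n -> 'rV[R]_4) i :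
  \sum_m w m = 1 -> bary i (\sum_m w m *: v m) = \sum_m w m * bary i (v m).
Proof.
move=> w1; rewrite baryE -[(_ == _)%:R]mul1r -{1}w1 mulr_suml.
have -> : dot (\sum_m w m *: v m) (bary_grad i) =
    \sum_m w m * dot (v m) (bary_grad i).
  elim/big_rec2: _ => [|m _ u _ <-]; last by rewrite dotDl dotZl.
  by rewrite /dot big1// => j _; rewrite mxE mul0r.
by rewrite -big_split; apply: eq_bigr => m _; rewrite baryE mulrDr.
Qed.

Lemma bary_expand x : x = \sum_i bary i x *: vertex R i.
Proof.
rewrite big_ord_recl /vertex unlift_none scaler0 add0r {1}(row_sum_delta x).
by apply: eq_bigr => j _; rewrite /bary !liftK.
Qed.

Lemma pentatopeP x : pentatope x <-> forall i, 0 <= bary i x.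
Proof.
split=> [[w [w0 w1 ->]] i|h].
  rewrite bary_comb// sumr_ge0// => l _.
  by rewrite mulr_ge0// bary_vertex ler0n.
by exists (bary^~ x); split=> //; [exact: sum_bary | exact: bary_expand].
Qed.

Lemma bary_facet_comb i (w : 'I_4 -> R) : \sum_m w m = 1 ->
  let x := \sum_m w m *: facet_vertex R i m in
  bary i x = 0 /\ forall m, bary (lift i m) x = w m.
Proof.
move=> w1 x; split=> [|m]; rewrite bary_comb//.
  rewrite big1// => m _.
  by rewrite bary_vertex (negPf (neq_lift _ _)) mulr0.
rewrite (bigD1 m)//= bary_vertex eqxx mulr1 big1 ?addr0// => l lm.
by rewrite bary_vertex (inj_eq lift_inj) eq_sym (negPf lm) mulr0.
Qed.

Lemma facetP i x : facet i x <-> pentatope x /\ bary i x = 0.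
Proof.
split=> [[w [w0 w1 ->]]|[/pentatopeP x0 xi]].
  have [bi bl] := bary_facet_comb i w1.
  split=> //; apply/pentatopeP => l.
  by have [m ->|->] := unliftP i l; rewrite ?bi// bl.
exists (fun m => bary (lift i m) x); split=> //.
  by rewrite -(sum_bary x) [RHS](bigD1_ord i)//= xi add0r.
by rewrite {1}(bary_expand x) (bigD1_ord i)//= xi scale0r add0r.
Qed.

(** Moving in the direction of another vertex removes the weight of vertex [i]
    and gives it to that vertex, so the pentatope is mapped into facet [i]. *)
Lemma pentatope_slide i x : pentatope x ->
  facet i (x + bary i x *: (vertex R (lift i ord0) - vertex R i)).
Proof.
move=> /pentatopeP x0; set y := x + _.
have yE l : bary l y = bary l x + bary i x *
    ((l == lift i ord0)%:R - (l == i)%:R).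
  rewrite -!bary_vertex !(baryE l) dotDl dotZl dotDl dotNl; ring.
apply/facetP; split; last first.
  by rewrite yE eqxx (negPf (neq_lift _ _)) sub0r mulrN1 subrr.
apply/pentatopeP => l; rewrite yE; have [->|li] := eqVneq l i.
  by rewrite (negPf (neq_lift _ _)) sub0r mulrN1 subrr.
by rewrite subr0 addr_ge0// mulr_ge0// ler0n.
Qed.

Definition bary_mpoly i : mpoly 4 R :=
  if unlift ord0 i is Some j then mpolyX R (mnm1 j)
  else 1 - \sum_j mpolyX R (mnm1 j).

Lemma msize_bary i : (msize (bary_mpoly i) <= 2)%N.
Proof.
rewrite /bary_mpoly; case: unlift => [j|]; first by rewrite msizeX mdeg1.
apply: msizeD_bound; first by rewrite msize1.
by rewrite msizeN; apply: msize_sum_bound => j _; rewrite msizeX mdeg1.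
Qed.

Lemma bary_mpolyE i x : mpoly_fun (bary_mpoly i) x = bary i x.
Proof.
rewrite /mpoly_fun /bary_mpoly /bary; case: unlift => [j|].
  by rewrite mevalXU.
rewrite mevalB meval1 meval_sum; congr (_ - _).
by apply: eq_bigr => j _; rewrite mevalXU.
Qed.

(** By [pentatope_slide], subtracting from [p] its value at the slid point
    changes nothing on the pentatope, and the difference is divisible by the
    coordinate [bary i], the length of the slide. *)
Lemma bary_divides i d (p : mpoly 4 R) : (msize p <= d.+1)%N ->
  (forall x, facet i x -> mpoly_fun p x = 0) ->
  exists2 r : mpoly 4 R, (msize r <= d)%N &
    forall x, pentatope x -> mpoly_fun p x = bary i x * mpoly_fun r x.
Proof.
move=> hp p0; set a := vertex R (lift i ord0) - vertex R i.
have [s hs Es] := meval_shift (fun j => a 0 j) (msize_bary i) hp.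
exists (- s); first by rewrite msizeN.
move=> x /(pentatope_slide i)/p0; have := Es (fun j => x 0 j).
rewrite -/(mpoly_fun _ x) bary_mpolyE -/(mpoly_fun s x) -/(mpoly_fun p x).
rewrite [mpoly_fun (- s) x]mevalN mulrN -/(mpoly_fun s x) => E.
rewrite {1}/mpoly_fun
  (_ : meval _ p = mpoly_fun p x + bary i x * mpoly_fun s x).
  by move/eqP; rewrite addr_eq0 => /eqP.
by rewrite -E; apply: meval_eq => j; rewrite !mxE.
Qed.

End Barycentric.

(** * Nonnegative functions with zero integral *)

Section VanishingIntegral.
Context d (T : measurableType d) (R : realType).
Variables (D : set T) (N : T -> set_system T).
Hypothesis N_filter : forall t, Filter (N t).

(** What an integrand needs.  [N t] stands for the neighbourhoods of [t]: the
    filters are a parameter because the product sigma-algebra and the product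
    topology are carried by two presentations of the same product type. *)
Definition tame (f : T -> R) : Prop :=
  [/\ measurable_fun setT f, exists M, forall t, D t -> `|f t| <= M &
      forall t, f @ N t --> f t].

Lemma tame_cst c : tame (fun=> c).
Proof.
split; [exact: measurable_cst | by exists `|c| | ].
by move=> t; have := N_filter t => ?; exact: cvg_cst.
Qed.

Lemma tameD f g : tame f -> tame g -> tame (fun t => f t + g t).
Proof.
move=> [mf [Mf bf] cf] [mg [Mg bg] cg]; split.
- exact: measurable_funD.
- exists (Mf + Mg) => t Dt.
  by rewrite (le_trans (ler_normD _ _))// lerD ?bf ?bg.
- by move=> t; have := N_filter t => ?; exact: cvgD.
Qed.

Lemma tameM f g : tame f -> tame g -> tame (fun t => f t * g t).
Proof.
move=> [mf [Mf bf] cf] [mg [Mg bg] cg]; split.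
- exact: measurable_funM.
- by exists (Mf * Mg) => t Dt; rewrite normrM ler_pM ?bf ?bg.
- by move=> t; have := N_filter t => ?; exact: cvgM.
Qed.

Lemma tame_sum (I : Type) (s : seq I) (F : I -> T -> R) :
  (forall i, tame (F i)) -> tame (fun t => \sum_(i <- s) F i t).
Proof.
move=> hF; elim: s => [|i s IH].
  by under eq_fun do rewrite big_nil; exact: tame_cst.
by under eq_fun do rewrite big_cons; exact: tameD.
Qed.

Lemma tame_prod (I : Type) (s : seq I) (F : I -> T -> R) :
  (forall i, tame (F i)) -> tame (fun t => \prod_(i <- s) F i t).
Proof.
move=> hF; elim: s => [|i s IH].
  by under eq_fun do rewrite big_nil; exact: tame_cst.
by under eq_fun do rewrite big_cons; exact: tameM.
Qed.

Lemma tameX f n : tame f -> tame (fun t => f t ^+ n).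
Proof.
move=> hf; elim: n => [|n IH].
  by under eq_fun do rewrite expr0; exact: tame_cst.
by under eq_fun do rewrite exprS; exact: tameM.
Qed.

Lemma tame_mpoly_fun (p : mpoly 4 R) (x : T -> 'rV[R]_4) :
  (forall j, tame (fun t => x t 0 j)) -> tame (fun t => mpoly_fun p (x t)).
Proof.
move=> hx; under eq_fun do rewrite /mpoly_fun mevalE.
apply: tame_sum => m; apply: tameM; first exact: tame_cst.
by apply: tame_prod => j; exact/tameX/hx.
Qed.

Variable mu : {measure set T -> \bar R}.

(** The last condition lets the integral detect values at boundary points
    of [D]; an isolated point or a whisker of [D] would be invisible. *)
Definition fat : Prop :=
  [/\ measurable D, (mu D < +oo)%E &
      forall t U, D t -> N t U -> exists B,
        [/\ measurable B, B `<=` D `&` U & (0 < mu B)%E]].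

(** Boundedness and [mu D < +oo] make the extended integral finite, which is
    needed because a real integral is also 0 when the extended one is
    infinite. *)
Lemma Rintegral_eq0_tame f : fat -> tame f -> (forall t, D t -> 0 <= f t) ->
  \int[mu]_(t in D) f t = 0 -> forall t, D t -> f t = 0.
Proof.
move=> [mD finD hB] [mf [M bf] cf] f0 If t Dt.
apply/eqP; rewrite eq_le f0// andbT leNgt; apply/negP => ft.
have FN := N_filter t.
have half : f t / 2 < f t by lra.
have near_half : N t [set s | f t / 2 < f s] by exact: (cvgr_gt (f t)).
have [B [mB BDU B0]] := hB _ _ Dt near_half.
have mfD : measurable_fun D (EFin \o f).
  by apply/measurable_EFinP; exact: measurable_funS mf.
have BD : B `<=` D by move=> s /BDU[].
have pos : (0 < \int[mu]_(s in D) (f s)%:E)%E.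
  apply: (@lt_le_trans _ _ (\int[mu]_(s in B) (f t / 2)%:E)%E).
    by rewrite integral_cst// mule_gt0// lte_fin divr_gt0.
  apply: (@le_trans _ _ (\int[mu]_(s in B) (f s)%:E)%E).
    apply: ge0_le_integral => //.
    - by move=> s _; rewrite lee_fin divr_ge0// ltW.
    - exact: measurable_funS mfD.
    - by move=> s /BDU[_ /ltW]; rewrite lee_fin.
  by apply: ge0_subset_integral => // s Ds; rewrite lee_fin f0.
have fin : (\int[mu]_(s in D) (f s)%:E < +oo)%E.
  apply: (@le_lt_trans _ _ (\int[mu]_(s in D) M%:E)%E).
    apply: ge0_le_integral => // s Ds.
    by rewrite lee_fin (le_trans (ler_norm _)) ?bf.
  have M0 : 0 <= M := le_trans (normr_ge0 _) (bf _ Dt).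
  by rewrite integral_cst// lte_mul_pinfty// lee_fin.
have := fine_gt0 (introT andP (conj pos fin)).
by move: If; rewrite /Rintegral => ->; rewrite ltxx.
Qed.

End VanishingIntegral.

(** * Coordinate simplices in dimensions 3 and 4 *)

Section Simplices.
Variable R : realType.
Local Notation leb := (@lebesgue_measure R).
Local Notation leb3 := ((leb \x leb) \x leb)%E.
Local Notation leb4 := (((leb \x leb) \x leb) \x leb)%E.
Local Notation mR := (measurableTypeR R).
Local Notation mR3 := (mR * mR * mR)%type.
Local Notation mR4 := (mR * mR * mR * mR)%type.

(** The casts select the product topology on the type whose sigma-algebra the
    Lebesgue measure uses. *)
Definition nbhs3 (t : mR3) : set_system mR3 := nbhs (t : R * R * R).
Definition nbhs4 (t : mR4) : set_system mR4 := nbhs (t : R * R * R * R).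

Lemma nbhs3_filter t : Filter (nbhs3 t).
Proof. exact: nbhs_filter. Qed.

Lemma nbhs4_filter t : Filter (nbhs4 t).
Proof. exact: nbhs_filter. Qed.

Definition simplex n (x : 'rV[R]_n) : Prop :=
  (forall j, 0 <= x 0 j) /\ \sum_j x 0 j <= 1.

Lemma simplex_le1 n (x : 'rV[R]_n) j : simplex x -> 0 <= x 0 j <= 1.
Proof.
move=> [x0 x1]; rewrite x0 (le_trans _ x1)// (bigD1 j)//= lerDl.
by apply: sumr_ge0.
Qed.

(** Side of a box near a point of the simplex: the homothety of ratio [1 - e]
    centred at the origin pushes the point away from the slanted face, which
    leaves a total room of [e] to be shared among the coordinates. *)
Definition cell (e w x : R) : set R := `](1 - e) * x, (1 - e) * x + e * w[.

Lemma simplex_cell n (e : R) (x y : 'rV[R]_n.+1) : 0 < e <= 1 -> simplex x ->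
  (forall j, cell e n.+1%:R^-1 (x 0 j) (y 0 j)) ->
  simplex y /\ forall j, `|x 0 j - y 0 j| < e.
Proof.
move=> /andP[e0 e1] hx hy.
have hy' j : (1 - e) * x 0 j < y 0 j < (1 - e) * x 0 j + e * n.+1%:R^-1.
  by have := hy j; rewrite /cell/= in_itv.
have [x0 x1] := hx.
have h5 : 0 < n.+1%:R^-1 :> R by rewrite invr_gt0 ltr0n.
have h6 : n.+1%:R^-1 <= 1 :> R by rewrite invf_le1 ?ltr0n// ler1n.
split; last first.
  move=> j; have /andP[h1 h2] := hy' j; have /andP[h3 h4] := simplex_le1 j hx.
  have ex0 : 0 <= e * x 0 j by rewrite mulr_ge0// ltW.
  have ex1 : e * x 0 j <= e by rewrite ger_pMr.
  have ew1 : e * n.+1%:R^-1 <= e by rewrite ger_pMr.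
  move: h1 h2 ew1; rewrite mulrBl mul1r ltr_norml.
  move: (e * _) (e * _) ex0 ex1 => a b ex0 ex1 h1 h2 ew1.
  by apply/andP; split; lra.
split=> [j|].
  have /andP[/ltW h1 _] := hy' j; apply: le_trans h1.
  by rewrite mulr_ge0 ?subr_ge0.
have : \sum_j y 0 j <= \sum_j ((1 - e) * x 0 j + e * n.+1%:R^-1).
  by apply: ler_sum => j _; have /andP[_ /ltW] := hy' j.
rewrite big_split -mulr_sumr/= sumr_const card_ord -(mulr_natr (e * _)) -mulrA.
rewrite mulVf ?pnatr_eq0// => h; apply: le_trans h _.
by rewrite mulr1 -lerBrDr ler_piMr// subr_ge0.
Qed.

Lemma lebesgue_cell (e w x : R) : 0 < e * w -> leb (cell e w x) = (e * w)%:E.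
Proof.
move=> ew; rewrite /cell lebesgue_measure_itv/= lte_fin ltrDl ew.
by rewrite -EFinB addrAC subrr add0r.
Qed.

Lemma measurable_cell (e w x : R) : measurable (cell e w x).
Proof. exact: measurable_itv. Qed.

Lemma measurable_simplex d (T : measurableType d) n (x : T -> 'rV[R]_n) :
  (forall j, measurable_fun setT (fun t => x t 0 j)) ->
  measurable [set t | simplex (x t)].
Proof.
move=> mx.
have -> : [set t | simplex (x t)] =
    (\bigcap_(j in [set: 'I_n]) ((fun t => x t 0 j) @^-1` `[0, +oo[))
    `&` (fun t => \sum_j x t 0 j) @^-1` `]-oo, 1].
  apply/seteqP; split=> t.
    by move=> [h1 h2]; split=> [j _|]; rewrite /= in_itv/= ?andbT.
  move=> [h1]; rewrite /= in_itv/= => h2; split=> // j.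
  by have := h1 j I; rewrite /= in_itv/= andbT.
apply: measurableI.
  apply: fin_bigcap_measurable => // j _.
  by rewrite -[X in measurable X]setTI; apply: mx.
rewrite -[X in measurable X]setTI.
by apply: (measurable_sum _ mx).
Qed.

Lemma measurable_row3 j : measurable_fun setT (fun t : mR3 => row3 t 0 j).
Proof.
under eq_fun do rewrite mxE.
case: j => -[|[|[|//]]] hj /=.
- exact: (measurableT_comp measurable_fst measurable_fst).
- exact: (measurableT_comp measurable_snd measurable_fst).
- exact: measurable_snd.
Qed.

Lemma measurable_row4 j :
  measurable_fun setT (fun t : mR4 => row4 t 0 j).
Proof.
under eq_fun do rewrite mxE.
case: j => -[|[|[|[|//]]]] hj /=.
- exact: (measurableT_comp
    (measurableT_comp measurable_fst measurable_fst) measurable_fst).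
- exact: (measurableT_comp
    (measurableT_comp measurable_snd measurable_fst) measurable_fst).
- exact: (measurableT_comp measurable_snd measurable_fst).
- exact: measurable_snd.
Qed.

Lemma cvg_row3 j (t : mR3) : row3 s 0 j @[s --> nbhs3 t] --> row3 t 0 j.
Proof.
rewrite mxE; under eq_fun do rewrite mxE.
case: j => -[|[|[|//]]] hj /=.
- exact: (cvg_comp _ _ cvg_fst cvg_fst).
- exact: (cvg_comp _ _ cvg_fst cvg_snd).
- exact: cvg_snd.
Qed.

Lemma cvg_row4 j (t : mR4) : row4 s 0 j @[s --> nbhs4 t] --> row4 t 0 j.
Proof.
rewrite mxE; under eq_fun do rewrite mxE.
case: j => -[|[|[|[|//]]]] hj /=.
- exact: (cvg_comp _ _ cvg_fst (cvg_comp _ _ cvg_fst cvg_fst)).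
- exact: (cvg_comp _ _ cvg_fst (cvg_comp _ _ cvg_fst cvg_snd)).
- exact: (cvg_comp _ _ cvg_fst cvg_snd).
- exact: cvg_snd.
Qed.

Lemma tame_row3 j :
  tame [set t : mR3 | simplex (row3 t)] nbhs3 (fun t => row3 t 0 j).
Proof.
split; [exact: measurable_row3 | | exact: cvg_row3].
by exists 1 => t /(simplex_le1 j) /andP[h0 h1]; rewrite ger0_norm.
Qed.

Lemma tame_row4 j :
  tame [set t : mR4 | simplex (row4 t)] nbhs4 (fun t => row4 t 0 j).
Proof.
split; [exact: measurable_row4 | | exact: cvg_row4].
by exists 1 => t /(simplex_le1 j) /andP[h0 h1]; rewrite ger0_norm.
Qed.

Lemma leb_prod3 (A B C : set R) : measurable A -> measurable B ->
  measurable C -> leb3 (A `*` B `*` C) = (leb A * leb B * leb C)%E.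
Proof.
move=> mA mB mC; rewrite product_measure1E//; last exact: measurableX.
by congr (_ * _)%E; exact: product_measure1E.
Qed.

Lemma leb_prod4 (A B C D : set R) : measurable A -> measurable B ->
  measurable C -> measurable D ->
  leb4 (A `*` B `*` C `*` D) = (leb A * leb B * leb C * leb D)%E.
Proof.
move=> mA mB mC mD; rewrite product_measure1E//; last first.
  by apply: measurableX => //; exact: measurableX.
by congr (_ * _)%E; exact: leb_prod3.
Qed.

Lemma leb3_cell_gt0 (e w x y z : R) : 0 < e * w ->
  (0 < leb3 (cell e w x `*` cell e w y `*` cell e w z))%E.
Proof.
move=> ew; rewrite leb_prod3; [|exact: measurable_cell..].
by rewrite !lebesgue_cell// !mule_gt0// lte_fin.
Qed.

Lemma leb4_cell_gt0 (e w x y z u : R) : 0 < e * w ->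
  (0 < leb4 (cell e w x `*` cell e w y `*` cell e w z `*` cell e w u))%E.
Proof.
move=> ew; rewrite leb_prod4; [|exact: measurable_cell..].
by rewrite !lebesgue_cell// !mule_gt0// lte_fin.
Qed.

(** The box of cells at [t], with [e] small, lies both in the simplex and in
    the given neighbourhood of [t]. *)
Lemma fat_simplex3 :
  fat [set t : mR3 | simplex (row3 t)] nbhs3 leb3.
Proof.
have mD := measurable_simplex measurable_row3.
split=> //.
  apply: (@le_lt_trans _ _ (leb3 (`[0, 1] `*` `[0, 1] `*` `[0, 1]))).
    apply: le_measure; rewrite ?inE.
    - exact: mD.
    - by do 2?apply: measurableX.
    - move=> [[a b] c] h.
      have := simplex_le1 (inord 0) h; have := simplex_le1 (inord 1) h.
      have := simplex_le1 (inord 2) h.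
      by rewrite !mxE !inordK.
  rewrite leb_prod3// !lebesgue_measure_itv/= lte01 oppr0 adde0 !mule1.
  by rewrite ltry.
move=> t U Dt /nbhs_ballP[e e0 teU].
pose f := Num.min e 1.
have hf : 0 < f <= 1 by rewrite /f lt_min e0 ltr01/= ge_min lexx orbT.
have f0 : 0 < f * 3%:R^-1 by rewrite mulr_gt0 ?invr_gt0//; case/andP: hf.
exists (cell f 3%:R^-1 t.1.1 `*` cell f 3%:R^-1 t.1.2 `*` cell f 3%:R^-1 t.2).
split.
- by do 2?apply: measurableX; exact: measurable_cell.
- move=> s [[s1 s2] s3].
  have [|Ds ds] := simplex_cell (y := row3 s) hf Dt.
    by move=> j; rewrite !mxE; case: j => -[|[|[|//]]].
  split=> //; apply: teU.
  have fe j : `|row3 t 0 j - row3 s 0 j| < e.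
    by rewrite (lt_le_trans (ds j))// /f ge_min lexx.
  have := fe (inord 0); have := fe (inord 1); have := fe (inord 2).
  by rewrite !mxE !inordK.
- exact: leb3_cell_gt0.
Qed.

Lemma fat_simplex4 :
  fat [set t : mR4 | simplex (row4 t)] nbhs4 leb4.
Proof.
have mD := measurable_simplex measurable_row4.
split=> //.
  apply: (@le_lt_trans _ _
      (leb4 (`[0, 1] `*` `[0, 1] `*` `[0, 1] `*` `[0, 1]))).
    apply: le_measure; rewrite ?inE.
    - exact: mD.
    - by do 3?apply: measurableX.
    - move=> [[[a b] c] d] h.
      have := simplex_le1 (inord 0) h; have := simplex_le1 (inord 1) h.
      have := simplex_le1 (inord 2) h; have := simplex_le1 (inord 3) h.
      by rewrite !mxE !inordK.
  rewrite leb_prod4// !lebesgue_measure_itv/= lte01 oppr0 adde0 !mule1.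
  by rewrite ltry.
move=> t U Dt /nbhs_ballP[e e0 teU].
pose f := Num.min e 1.
have hf : 0 < f <= 1 by rewrite /f lt_min e0 ltr01/= ge_min lexx orbT.
have f0 : 0 < f * 4%:R^-1 by rewrite mulr_gt0 ?invr_gt0//; case/andP: hf.
exists (cell f 4%:R^-1 t.1.1.1 `*` cell f 4%:R^-1 t.1.1.2
        `*` cell f 4%:R^-1 t.1.2 `*` cell f 4%:R^-1 t.2).
split.
- by do 3?apply: measurableX; exact: measurable_cell.
- move=> s [[[s1 s2] s3] s4].
  have [|Ds ds] := simplex_cell (y := row4 s) hf Dt.
    by move=> j; rewrite !mxE; case: j => -[|[|[|[|//]]]].
  split=> //; apply: teU.
  have fe j : `|row4 t 0 j - row4 s 0 j| < e.
    by rewrite (lt_le_trans (ds j))// /f ge_min lexx.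
  have := fe (inord 0); have := fe (inord 1); have := fe (inord 2).
  have := fe (inord 3).
  by rewrite !mxE !inordK.
- exact: leb4_cell_gt0.
Qed.

End Simplices.

(** * Integrals over the pentatope and its facets *)

Section Charts.
Variable R : realType.
Local Notation mR := (measurableTypeR R).
Local Notation mR3 := (mR * mR * mR)%type.

Lemma pentatope_simplex (x : 'rV[R]_4) : pentatope x <-> simplex x.
Proof.
split=> [/pentatopeP h|[x0 x1]].
  split=> [j|]; last by have := h ord0; rewrite /bary unlift_none subr_ge0.
  by have := h (lift ord0 j); rewrite /bary liftK.
apply/pentatopeP => i; rewrite /bary; case: unlift => [j|] //.
by rewrite subr_ge0.
Qed.

Definition chart_weight (t : R * R * R) (m : 'I_4) : R :=
  if unlift ord0 m is Some l then row3 t 0 l else 1 - \sum_l row3 t 0 l.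

Lemma sum_chart_weight t : \sum_m chart_weight t m = 1.
Proof.
rewrite big_ord_recl /chart_weight unlift_none.
by under [X in _ + X]eq_bigr do rewrite liftK; rewrite subrK.
Qed.

Lemma facet_chartE i (t : R * R * R) :
  facet_chart i t = \sum_m chart_weight t m *: facet_vertex R i m.
Proof.
rewrite big_ord_recl /chart_weight unlift_none scalerBl scale1r -addrA.
congr (_ + _); rewrite scaler_suml -sumrN -big_split mulmx_sum_row.
apply: eq_bigr => m _.
by rewrite liftK rowK scalerBr addrC.
Qed.

(** [t] lists all barycentric coordinates of the chart point except those of
    the opposite vertex and of the base vertex of the chart. *)
Lemma facet_chart_preimage i :
  @facet_chart R i @^-1` facet i = [set t | simplex (row3 t)].
Proof.
apply/seteqP; split=> t /=;
    have [bi bl] := bary_facet_comb i (sum_chart_weight t);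
    rewrite facet_chartE facetP pentatopeP.
  move=> [h _]; split=> [m|].
    by have := h (lift i (lift ord0 m)); rewrite bl /chart_weight liftK.
  by have := h (lift i ord0); rewrite bl /chart_weight unlift_none subr_ge0.
move=> [h0 h1]; split=> // l; have [m ->|->] := unliftP i l; rewrite ?bi// bl.
by rewrite /chart_weight; case: unlift => [j|] //; rewrite subr_ge0.
Qed.

Lemma facet_chart_onto i (x : 'rV[R]_4) :
  facet i x -> exists t, facet_chart i t = x.
Proof.
move=> /facetP[_ xi].
pose b m := bary (lift i (lift ord0 m)) x.
exists (b (inord 0), b (inord 1), b (inord 2)).
have row_b : row3 (b (inord 0), b (inord 1), b (inord 2)) = \row_m b m.
  apply/rowP => -[[|[|[|//]]] hm]; rewrite !mxE /=;
    by congr b; apply/val_inj; rewrite /= inordK.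
rewrite facet_chartE [RHS]bary_expand (bigD1_ord i)//= xi scale0r add0r.
apply: eq_bigr => m _; congr (_ *: _).
have sumb : \sum_l b l = 1 - bary (lift i ord0) x.
  rewrite -(sum_bary x) [X in _ = X - _](bigD1_ord i)//= xi add0r.
  by rewrite [in RHS]big_ord_recl addrAC subrr add0r.
rewrite /chart_weight row_b; case: unliftP => [l|] ->; first by rewrite mxE.
by under eq_bigr do rewrite mxE; rewrite sumb subKr.
Qed.

Lemma vertex_coord (l : 'I_5) j : vertex R l 0 j = (lift ord0 j == l)%:R.
Proof. by rewrite -bary_vertex /bary liftK. Qed.

Lemma edge_coord (a b : 'I_5) j : (vertex R a - vertex R b) 0 j =
  (lift ord0 j == a)%:R - (lift ord0 j == b)%:R.
Proof. by rewrite !mxE !vertex_coord. Qed.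

Lemma sum_eq_eq n (a b : 'I_n) :
  \sum_l (l == a)%:R * (l == b)%:R = (a == b)%:R :> R.
Proof.
rewrite (bigD1 a)//= eqxx mul1r big1 ?addr0// => l /negPf ->.
by rewrite mul0r.
Qed.

(** The coordinates of a vertex are its last four barycentric coordinates.
    Summing over all five makes the edges differences of unit vectors with a
    common origin, of Gram matrix 1 + J (J the all-ones matrix); the extra
    term is 0 for facet 0 and 1 for the facets through the origin. *)
Lemma facet_gramE i m n :
  (facet_edges R i *m (facet_edges R i)^T) m n =
  (m == n)%:R + (i == ord0)%:R.
Proof.
rewrite mxE; under eq_bigr do rewrite [(_^T) _ _]mxE !(mxE matrix_key).
pose p := lift i (lift ord0 m); pose q := lift i (lift ord0 n).
pose o := lift i ord0.
pose F (l : 'I_5) : R :=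
  ((l == p)%:R - (l == o)%:R) * ((l == q)%:R - (l == o)%:R).
rewrite (eq_bigr (fun j => F (lift ord0 j))); last first.
  by move=> j _; rewrite /facet_vertex !edge_coord.
have sumF : \sum_l F l = (m == n)%:R + 1.
  under eq_bigr do rewrite /F mulrBl !mulrBr.
  rewrite !sumrB !sum_eq_eq /p /q /o !(inj_eq lift_inj) eqxx.
  by rewrite [lift _ _ == ord0]eq_sym !(negPf (neq_lift _ _)) subr0 sub0r opprK.
have : F ord0 + \sum_j F (lift ord0 j) = (m == n)%:R + 1.
  by rewrite -sumF [RHS]big_ord_recl.
have F0 : F ord0 = (i != ord0)%:R.
  rewrite /F /p /q /o; case: (eqVneq i ord0) => [->|i0].
    by rewrite !(negPf (neq_lift _ _)) subrr mul0r.
  have -> : lift i ord0 = ord0.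
    by apply/val_inj; rewrite /= /bump leqNgt lt0n i0.
  have pos k : (ord0 == lift i (lift ord0 k)) = false.
    by apply/eqP => /(congr1 val); rewrite /= /bump; lia.
  by rewrite !pos eqxx sub0r mulrNN mulr1.
rewrite F0; case: eqVneq => _ /=; first by rewrite add0r.
by rewrite addr0 addrC => /addIr.
Qed.

Lemma det_mx2 (A : 'M[R]_2) :
  \det A = A ord0 ord0 * A ord_max ord_max - A ord0 ord_max * A ord_max ord0.
Proof.
rewrite (expand_det_row A ord0) !big_ord_recl big_ord0 /cofactor !det_mx11.
rewrite !mxE /= /bump/=.
have -> : lift ord0 ord0 = ord_max :> 'I_2 by apply/val_inj.
have -> : lift ord_max 0 = ord0 :> 'I_2 by apply/val_inj.
by rewrite addr0 expr0 expr1 mul1r mulN1r mulrN.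
Qed.

Lemma facet_gram_gt0 i :
  0 < \det (facet_edges R i *m (facet_edges R i)^T).
Proof.
move: (_ *m _) (facet_gramE i) => M ME.
(* The matrix is 1 + c J with c = 0 or 1, of determinant 1 + 3 c. *)
rewrite (expand_det_row _ ord0) !big_ord_recl big_ord0 /cofactor !det_mx2.
rewrite !mxE !ME (_ : 0 + bump 0 0 = 1)%N// (_ : 0 + bump 0 (bump 0 0) = 2)%N//.
rewrite expr0 expr1 sqrrN expr1n /=.
by case: (i == ord0); rewrite /=; lra.
Qed.

Lemma tame_facet_chart i j :
  tame [set t : mR3 | simplex (row3 t)] (@nbhs3 R)
    (fun t => @facet_chart R i t 0 j).
Proof.
have hN := @nbhs3_filter R.
have -> : (fun t => @facet_chart R i t 0 j) = (fun t =>
    facet_vertex R i ord0 0 j + \sum_m row3 t 0 m * facet_edges R i m j).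
  by apply/funext => t; rewrite /facet_chart mxE [(_ *m _) _ _]mxE.
apply: tameD => //; first exact: tame_cst.
apply: tame_sum => // m; apply: tameM => //; last exact: tame_cst.
exact: tame_row3.
Qed.

Lemma facet_integral_eq0 i (f : 'rV[R]_4 -> R) (p : mpoly 4 R) :
  (forall x, facet i x -> f x = mpoly_fun p x) ->
  (forall x, facet i x -> 0 <= f x) ->
  facet_integral i f = 0 -> forall x, facet i x -> f x = 0.
Proof.
move=> fp f0 /eqP; rewrite mulf_eq0 sqrtr_eq0 leNgt facet_gram_gt0/=.
rewrite facet_chart_preimage => /eqP If x /[dup] hx.
have onF s : facet i (@facet_chart R i s) = simplex (row3 s).
  exact: (congr1 (fun D => D s) (facet_chart_preimage i)).
have [t <-] := facet_chart_onto hx => ht.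
have hN := @nbhs3_filter R.
have tm := tame_mpoly_fun hN p (tame_facet_chart i).
rewrite fp//; apply: (Rintegral_eq0_tame hN (@fat_simplex3 R) tm).
- by move=> s hs; rewrite -fp ?f0 ?onF.
- rewrite -[RHS]If; apply: eq_Rintegral => s.
  by rewrite inE => hs; rewrite fp ?onF.
- by rewrite /= -onF.
Qed.

Lemma volume_integral_eq0 (f : 'rV[R]_4 -> R) (p : mpoly 4 R) :
  (forall x, pentatope x -> f x = mpoly_fun p x) ->
  (forall x, pentatope x -> 0 <= f x) ->
  volume_integral (@pentatope R) f = 0 -> forall x, pentatope x -> f x = 0.
Proof.
move=> fp f0; rewrite /volume_integral.
have -> : (@row4 R) @^-1` (@pentatope R) = [set t | simplex (row4 t)].
  by apply/seteqP; split=> t /= /pentatope_simplex.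
move=> If x hx.
have [t tx] : exists t, row4 t = x.
  exists (x 0 (inord 0), x 0 (inord 1), x 0 (inord 2), x 0 (inord 3)).
  apply/rowP => -[[|[|[|[|//]]]] hm]; rewrite !mxE /=;
    by congr (x 0 _); apply/val_inj; rewrite /= inordK.
have hN := @nbhs4_filter R.
have tm := tame_mpoly_fun hN p (@tame_row4 R).
rewrite fp// -tx.
apply: (Rintegral_eq0_tame hN (@fat_simplex4 R) tm).
- by move=> s /pentatope_simplex hs; rewrite -fp ?f0.
- rewrite -[RHS]If; apply: eq_Rintegral => s.
  by rewrite inE => /pentatope_simplex hs; rewrite fp.
- by rewrite /= tx -pentatope_simplex.
Qed.

End Charts.

(** * Unisolvence *)

Section Unisolvence.
Variable R : realType.
Implicit Types (G : 'rV[R]_4 -> 'rV[R]_4) (x : 'rV[R]_4).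

Lemma mdegree_leP k (p : mpoly 4 R) : (0 < k)%N ->
  mdegree_le (k%:Z - 1) p = (msize p <= k)%N.
Proof.
move=> k0; rewrite /mdegree_le subrK lez_nat.
by case: eqVneq => //= ->; rewrite msize0.
Qed.

Lemma mdegree_le_pred k (p : mpoly 4 R) : (0 < k)%N ->
  (msize p <= k.-1)%N -> mdegree_le (k%:Z - 2) p.
Proof.
by move=> k0 hp; apply/orP; right; case: k k0 hp => //= k _ hp; lia.
Qed.

(** On facet [i], where [bary i] vanishes, the component of [G] along
    [bary_grad i] is thus a polynomial of degree at most [k - 1], although [G]
    itself may have degree [k]. *)
Lemma V3_bary_components k G : (0 < k)%N -> V3 k G ->
  exists (Q : 'I_5 -> mpoly 4 R) (h : mpoly 4 R),
    (forall i, (msize (Q i) <= k)%N) /\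
    forall i x, pentatope x ->
      dot (G x) (bary_grad R i) = mpoly_fun (Q i) x + bary i x * mpoly_fun h x.
Proof.
move=> k0 [f [h [hf [ph homh hE] GE]]].
have /choice[pf hpf] : forall c : 'I_4, exists p : mpoly 4 R,
    (msize p <= k)%N /\ forall x, pentatope x -> f x 0 c = mpoly_fun p x.
  by move=> c; have [p] := hf c; rewrite mdegree_leP// => hp Ep; exists p.
have hph : (msize ph <= k)%N.
  rewrite msizeE; apply/bigmax_leqP_seq => m hm _.
  by move/dhomogP: homh => /(_ _ hm) /= ->; rewrite prednK.
exists (fun i => \sum_c bary_grad R i 0 c *: pf c - (i == ord0)%:R *: ph), ph.
split=> [i|i x hx].
  apply: msizeD_bound; last by rewrite msizeN; exact: msizeZ_bound.
  by apply: msize_sum_bound => c _; apply/msizeZ_bound/(hpf c).1.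
rewrite GE// dotDl dotZl hE// baryE /mpoly_fun mevalB meval_sum mevalZ.
have -> : dot (f x) (bary_grad R i) =
    \sum_c meval (fun j => x 0 j) (bary_grad R i 0 c *: pf c).
  by apply: eq_bigr => c _; rewrite mevalZ (hpf c).2// mulrC.
by ring.
Qed.

Lemma bary_grad_dot_gt0 i : 0 < dot (bary_grad R i) (bary_grad R i).
Proof.
rewrite /bary_grad; case: unlift => [j|].
  by rewrite dot_delta mxE !eqxx.
rewrite /dot (eq_bigr (fun=> 1)) => [|j _].
  by rewrite sumr_const card_ord.
by rewrite mxE mulrNN mulr1.
Qed.

Lemma unit_normal_bary_grad i :
  unit_normal i
    ((Num.sqrt (dot (bary_grad R i) (bary_grad R i)))^-1 *: bary_grad R i).
Proof.
have g0 := bary_grad_dot_gt0 i; set c := Num.sqrt _; split.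
  rewrite dotZl dotC dotZl -[dot _ _]sqr_sqrtr ?ltW// -/c.
  by rewrite mulrA -expr2 -exprMn mulVf ?expr1n// gt_eqF// sqrtr_gt0.
move=> x y /facetP[_ xi] /facetP[_ yi]; rewrite dotC dotDl dotNl.
rewrite dotC [dot y _]dotC !dotZl.
have : dot x (bary_grad R i) = dot y (bary_grad R i).
  by apply: (addrI (i == ord0)%:R); rewrite -!baryE xi yi.
by rewrite dotC => ->; rewrite [dot y _]dotC subrr.
Qed.

(** The normal component is its own test function. *)
Lemma facet_component_eq0 k G i (p : mpoly 4 R) : (0 < k)%N ->
  facet_dofs_vanish k G -> (msize p <= k)%N ->
  (forall x, facet i x -> dot (G x) (bary_grad R i) = mpoly_fun p x) ->
  forall x, facet i x -> mpoly_fun p x = 0.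
Proof.
move=> k0 hG hp Gp x hx.
have := unit_normal_bary_grad i; set c := _^-1 => hn.
have c0 : c != 0 by rewrite invr_eq0 gt_eqF// sqrtr_gt0 bary_grad_dot_gt0.
have Gn y : facet i y -> dot (G y) (c *: bary_grad R i) = mpoly_fun (c *: p) y.
  by move=> hy; rewrite dotC dotZl dotC Gp// /mpoly_fun mevalZ.
have hq : poly_space (k%:Z - 1) (facet i) (mpoly_fun (c *: p)).
  by exists (c *: p) => //; rewrite mdegree_leP// msizeZ_bound.
have := facet_integral_eq0 (p := (c *: p) * (c *: p)) _ _ (hG i _ hn _ hq) hx.
rewrite Gn// => /(_ _ _)/eqP; rewrite mulf_eq0 orbb /mpoly_fun mevalZ.
rewrite mulf_eq0 (negPf c0) => H; apply/eqP/H => y hy; rewrite Gn//.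
  by rewrite /mpoly_fun !mevalM.
by rewrite -expr2 sqr_ge0.
Qed.

(** As the components of [G] sum to 0, a common constant may be added to the
    [r i]: adding [- r ord0] gives the left-hand side, adding [h] the sum of
    squares. *)
Lemma sum_bary_square G x (r : 'I_5 -> R) h :
  (forall i, dot (G x) (bary_grad R i) = bary i x * (r i + h)) ->
  dot (G x) (\row_j (r (lift ord0 j) - r ord0)) =
  \sum_i bary i x * (r i + h) ^+ 2.
Proof.
move=> Gi.
have -> : \sum_i bary i x * (r i + h) ^+ 2 =
    \sum_i dot (G x) (bary_grad R i) * r i +
    \sum_i dot (G x) (bary_grad R i) * h.
  by rewrite -big_split; apply: eq_bigr => i _; rewrite Gi /=; ring.
rewrite -[X in _ + X]mulr_suml sum_bary_grad mul0r addr0.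
have -> : \sum_i dot (G x) (bary_grad R i) * r i =
    \sum_i dot (G x) (bary_grad R i) * (r i - r ord0).
  apply/eqP; rewrite -subr_eq0 -sumrB.
  under eq_bigr do rewrite mulrBr opprB addrCA subrr addr0.
  by rewrite -mulr_suml sum_bary_grad mul0r.
rewrite big_ord_recl subrr mulr0 add0r; apply: eq_bigr => j _.
by rewrite mxE /bary_grad liftK dot_delta.
Qed.

End Unisolvence.

Theorem lemma4p11 (R : realType) (k : nat) (G : 'rV[R]_4 -> 'rV[R]_4)
  (hk : (1 <= k)%N) (hG : V3 k G)
  (hfacet : facet_dofs_vanish k G) (hint : interior_dofs_vanish k G) :
  forall x : 'rV[R]_4, pentatope x -> G x = 0%R.
Proof.
have [Q [h [hQ GQ]]] := V3_bary_components hk hG.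
have /choice[r hr] : forall i, exists r : mpoly 4 R, (msize r <= k.-1)%N /\
    forall x, pentatope x -> mpoly_fun (Q i) x = bary i x * mpoly_fun r x.
  move=> i; have [||r hr Er] := @bary_divides R i k.-1 (Q i).
  - by rewrite prednK.
  - apply: (facet_component_eq0 hk hfacet (hQ i)) => x /facetP[hx xi].
    by rewrite GQ// xi mul0r addr0.
  - by exists r.
have Gr i x : pentatope x -> dot (G x) (bary_grad R i) =
    bary i x * (mpoly_fun (r i) x + mpoly_fun h x).
  by move=> hx; rewrite GQ// (hr i).2// mulrDr.
pose q x : 'rV[R]_4 :=
  \row_j (mpoly_fun (r (lift ord0 j)) x - mpoly_fun (r ord0) x).
have qE x : pentatope x -> dot (G x) (q x) =
    \sum_i bary i x * (mpoly_fun (r i) x + mpoly_fun h x) ^+ 2.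
  by move=> hx; apply: sum_bary_square => i; exact: Gr.
have hq : vpoly_space (k%:Z - 2) (@pentatope R) q.
  move=> j; exists (r (lift ord0 j) - r ord0).
    apply: mdegree_le_pred => //; apply: msizeD_bound; first exact: (hr _).1.
    by rewrite msizeN (hr _).1.
  by move=> x _; rewrite mxE /mpoly_fun mevalB.
have term_ge0 i x : pentatope x ->
    0 <= bary i x * (mpoly_fun (r i) x + mpoly_fun h x) ^+ 2.
  by move=> /pentatopeP hx; rewrite mulr_ge0// sqr_ge0.
have zero : forall x, pentatope x -> dot (G x) (q x) = 0.
  apply: (volume_integral_eq0 (p := \sum_i bary_mpoly R i * (r i + h) ^+ 2)).
  - move=> x hx; rewrite qE// /mpoly_fun meval_sum; apply: eq_bigr => i _.
    by rewrite -(bary_mpolyE i x) /mpoly_fun !expr2 !mevalM mevalD.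
  - by move=> x hx; rewrite qE// sumr_ge0// => i _; exact: term_ge0.
  - exact: hint.
move=> x hx; apply: bary_grad_eq0 => i.
have /eqP := zero x hx.
rewrite qE// psumr_eq0 => [/allP/(_ i)|j _]; last exact: term_ge0.
rewrite mem_index_enum => /(_ isT)/=.
by rewrite Gr// !mulf_eq0 orbb -mulf_eq0 => /eqP.
Qed.
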